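(* Let $(X,d)$ be a complete, connected, locally compact, non-compact geodesic space. For any dl-function $u:X\to\mathbb{R}$ and any $x\in X$, $$u(x)=\sup_{y\in X}\,[u(y)+u_y(x)].$$
   Context: A geodesic space is a length space in which the distance between any two points is attained by the length of some Lipschitz curve connecting them. For a non-empty closed set $H\subseteq X$, $d(x,H)=\inf_{h\in H}d(x,h)$. A function $u:X\to\mathbb{R}$ is a dl-function if there are a sequence of (non-empty) closed subsets $H_n\subseteq X$ diverging to infinity (i.e. $d(x_0,H_n)\to\infty$ for some $x_0\in X$) and real numbers $c_n$ such that $u(x)=\lim_{n\to\infty}[d(x,H_n)-c_n]$, the limit being in the compact-open topology (uniform on compact sets). For $y\in X$ and $r>0$ let $S_r(y)=\{x\in X: d(x,y)=r\}$; then $u_y:X\to\mathbb{R}$ is defined by $u_y(x)=\lim_{r\to+\infty}[d(x,S_r(y))-r]$ (this limit exists for every $x$). *)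

(* Defs.v *)
From mathcomp Require Import all_boot all_order all_algebra.
From mathcomp Require Import all_classical all_reals all_analysis.

Set Implicit Arguments.
Unset Strict Implicit.
Unset Printing Implicit Defensive.
Import Order.TTheory GRing.Theory Num.Theory.
Import numFieldNormedType.Exports.
Local Open Scope classical_set_scope.
Local Open Scope ring_scope.

Section MetricGeometry.
Context {R : realType} (X : metricType R).
Implicit Types (x y : X) (H : set X).

(* The axiom of [completeType], whose [cvg] requires a pointed type and whose
   structure is not joined with [metricType]. *)
Definition complete_space :=
  forall F : set_system X, ProperFilter F -> cauchy F -> exists l : X, F --> l.

Definition dist_set x H : R := inf [set mdist x h | h in H].

Definition metric_sphere y (r : R) : set X := [set x | mdist x y = r].

(* [total_variation] with the norm of a difference replaced by [mdist];
   lengths are extended real, and are meant for a <= b. *)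
Definition curve_length (a b : R) (g : R -> X) : \bar R :=
  ereal_sup [set (\sum_(0 <= n < size s)
      mdist (g (nth b (a :: s) n)) (g (nth b (a :: s) n.+1)))%:E
    | s in itv_partition a b].

Definition lipschitz_curve (a b : R) (g : R -> X) :=
  exists L : R, {in `[a, b] &, forall s t, mdist (g s) (g t) <= L * `|s - t|}.

Definition curve_lengths x y : set (\bar R) :=
  [set l | exists a b g, [/\ a <= b, lipschitz_curve a b g,
    g a = x, g b = y & l = curve_length a b g]].

Definition length_space :=
  forall x y, (mdist x y)%:E = ereal_inf (curve_lengths x y).

Definition geodesic_space :=
  length_space /\ forall x y, curve_lengths x y (mdist x y)%:E.

Definition dl_function (u : X -> R) :=
  exists (H : nat -> set X) (c : nat -> R),
    [/\ forall n, H n !=set0,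
        forall n, closed (H n),
        exists x0, dist_set x0 (H n) @[n --> \oo] --> +oo &
        {compact-open, (fun n x => dist_set x (H n) - c n) @ \oo --> u}].

(* The function u_y of the sphere S_r(y): the limit exists on the spaces
   considered here; otherwise [lim] is a default value. *)
Definition sphere_limit y x : R :=
  lim ((dist_set x (metric_sphere y r) - r) @[r --> +oo]).

End MetricGeometry.

(* Main.v *)
(** The value [y = x] attains the supremum, because [u_x(x) = 0].  For the
    inequality [u(y) + u_y(x) <= u(x)], put [f(r) = d(x, S_r(y)) - r].  A
    geodesic from [x] to a point of a large sphere about [y] crosses every
    smaller sphere whose radius is at least [d(x,y)]; hence [f] is nondecreasing
    for [r >= d(x,y)], with limit [u_y(x)].  A point [h] of [H_n] lies on its
    own sphere about [y], so [d(x,h) >= d(y,h) + f(d(y,h))]; by monotonicity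
    [d(x,H_n) >= d(y,H_n) + f(d(y,H_n))], and the claim follows by letting [n]
    tend to infinity. *)
Require Import Defs.
From mathcomp Require Import all_boot all_order all_algebra.
From mathcomp Require Import all_classical all_reals all_analysis.
From mathcomp Require Import lra.

Set Implicit Arguments.
Unset Strict Implicit.
Unset Printing Implicit Defensive.
Import Order.TTheory GRing.Theory Num.Theory.
Import numFieldNormedType.Exports.
Local Open Scope classical_set_scope.
Local Open Scope ring_scope.

Section DistSet.
Context {R : realType} (X : metricType R).
Implicit Types (x y h : X) (H : set X) (r : R).

Lemma dist_set_le x h H : H h -> dist_set x H <= mdist x h.
Proof.
move=> Hh; apply: ge_inf; last by exists h.
by exists 0 => _ [k _ <-]; exact: mdist_ge0.
Qed.

Lemma le_dist_set x H r : H !=set0 ->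
  (forall h, H h -> r <= mdist x h) -> r <= dist_set x H.
Proof.
move=> [h Hh] rH; apply: lb_le_inf; first by exists (mdist x h), h.
by move=> _ [k Hk <-]; exact: rH.
Qed.

Lemma dist_set_triangle x y H : H !=set0 ->
  dist_set x H <= mdist x y + dist_set y H.
Proof.
move=> H0; rewrite -lerBlDl; apply: le_dist_set => // h Hh.
rewrite lerBlDl; apply: le_trans (metric_triangle x y h).
exact: dist_set_le.
Qed.

Lemma metric_sphereE y r x : metric_sphere y r x = (mdist y x = r).
Proof. by rewrite metric_sym. Qed.

Lemma dist_set_metric_sphere y r : metric_sphere y r !=set0 ->
  dist_set y (metric_sphere y r) = r.
Proof.
move=> S0; apply/eqP; rewrite eq_le; apply/andP; split.
  have [h Sh] := S0; rewrite (le_trans (dist_set_le y Sh))//.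
  by move: Sh; rewrite metric_sphereE => ->.
by apply: le_dist_set => // h; rewrite metric_sphereE => ->.
Qed.

End DistSet.

Section Curves.
Context {R : realType} (X : metricType R).
Implicit Types (x y p : X) (a b t : R) (g : R -> X).

Lemma mdist_lipschitz_curve_continuous y a b g : lipschitz_curve a b g ->
  {within `[a, b], continuous (fun t => mdist y (g t))}.
Proof.
move=> [L gL]; apply/subspace_continuousP => t tab.
(* [L] has no prescribed sign, so its absolute value plus one serves as a positive Lipschitz
   constant. *)
have L0 : 0 < `|L| + 1 by rewrite ltr_wpDl.
apply/cvgrPdist_le => e e0; rewrite near_withinE /from_subspace.
near=> s => sab.
have st : `|t - s| <= e / (`|L| + 1).
  by near: s; apply: (@cvgr_dist_le _ _ _ _ _ id) => //; rewrite divr_gt0.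
have : mdist (g t) (g s) <= e.
  apply: (le_trans (gL t s tab sab)).
  apply: (@le_trans _ _ ((`|L| + 1) * `|t - s|)).
    by rewrite ler_wpM2r// (le_trans (ler_norm L))// lerDl.
  by rewrite -ler_pdivlMl// mulrC.
have := metric_triangle y (g t) (g s).
have := metric_triangle y (g s) (g t).
by rewrite [mdist (g s) (g t)]metric_sym ler_norml => *; apply/andP; split; lra.
Unshelve. all: by end_near. Qed.

(** The left side is the sum over the partition [a < t < b]. Partitions increase strictly, so
    [t = a] and [t = b] call for shorter ones. *)
Lemma mdistD_le_curve_length a b g t : t \in `[a, b] ->
  ((mdist (g a) (g t) + mdist (g t) (g b))%:E <= curve_length a b g)%E.
Proof.
rewrite in_itv/= => /andP[]; rewrite le_eqVlt => /predU1P[<-|at_].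
  rewrite mdistxx add0r le_eqVlt => /predU1P[->|ab].
    apply: ereal_sup_ubound; exists [::] => //=.
    by rewrite big_nil mdistxx.
  apply: ereal_sup_ubound; exists [:: b]; first by split => //=; rewrite ab.
  by rewrite /= big_nat1.
rewrite le_eqVlt => /predU1P[tb|tb].
  rewrite -tb mdistxx addr0.
  apply: ereal_sup_ubound; exists [:: t]; first by split => //=; rewrite at_.
  by rewrite /= big_nat1.
apply: ereal_sup_ubound; exists [:: t; b].
  by split => //=; rewrite at_ tb.
by rewrite /= big_nat_recr//= big_nat1.
Qed.

(** The intermediate value theorem for the distance to [y] along a shortest curve from [x] to [z]
    yields [p]; the detour through [p] is bounded by the length of that curve. *)
Lemma geodesic_meets_sphere x z y r : geodesic_space X ->
  mdist y x <= r <= mdist y z ->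
  exists2 p, mdist y p = r & mdist x p + mdist p z <= mdist x z.
Proof.
move=> [_ /(_ x z)] [a [b [g [ab gL gx gz len]]]] /andP[xr rz].
have gcont := @mdist_lipschitz_curve_continuous y _ _ _ gL.
have [|t tab tr] := @IVT _ _ _ _ r ab gcont.
  by rewrite gx gz ge_min le_max xr rz orbT.
exists (g t) => //; have := mdistD_le_curve_length g tab.
by rewrite -len lee_fin gx gz.
Qed.

End Curves.

Section SphereLimit.
Context {R : realType} (X : metricType R).
Context (X_geodesic : geodesic_space X).
Context (X_unbounded : forall (y : X) (r : R), exists z, r <= mdist y z).
Implicit Types (x y : X) (r s : R).

(** Needed because [dist_set] to an empty set is only a default value of [inf]. A geodesic issuing
    from the center [y] itself meets the sphere. *)
Lemma metric_sphere_nonempty y r : 0 <= r -> metric_sphere y r !=set0.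
Proof.
move=> r0; have [z rz] := X_unbounded y r.
have [|p pr _] := @geodesic_meets_sphere R X y z y r X_geodesic.
  by rewrite mdistxx r0.
by exists p; rewrite metric_sphereE.
Qed.

Lemma dist_sphere_nondecreasing x y r s : mdist y x <= r -> r <= s ->
  dist_set x (metric_sphere y r) - r <= dist_set x (metric_sphere y s) - s.
Proof.
move=> xr rs; rewrite lerBrDr; apply: le_dist_set.
  exact/metric_sphere_nonempty/(le_trans (mdist_ge0 y x))/(le_trans xr).
move=> h; rewrite metric_sphereE => hs.
have [|p pr ph] := @geodesic_meets_sphere R X x h y r X_geodesic.
  by rewrite xr hs rs.
(* Since [p] lies on a geodesic from [x] to [h], passing from [h] to [p] shortens the distance to
   [x] by at least [mdist p h], which is at least [s - r]. *)
have /(dist_set_le x) : metric_sphere y r p by rewrite metric_sphereE.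
have := metric_triangle y p h.
rewrite hs pr; lra.
Qed.

Lemma sphere_limit_cvg x y :
  dist_set x (metric_sphere y r) - r @[r --> +oo] --> sphere_limit y x.
Proof.
set f := fun r => dist_set x (metric_sphere y r) - r.
set m := mdist y x.
(* [f] is known to be monotone only from [m] on; replacing [r] by [Num.max m r] makes it monotone on
   the whole line without changing the limit. *)
suff fcvg : f r @[r --> +oo] --> sup (range (fun r => f (Num.max m r))).
  by apply/cvg_ex; eexists; exact: fcvg.
apply: cvg_trans (nondecreasing_cvgr (f := fun r => f (Num.max m r)) _ _).
- apply: near_eq_cvg; near=> r; have /max_r-> // : m <= r.
  by near: r; exact: nbhs_pinfty_ge (num_real _).
- move=> r s rs; apply: dist_sphere_nondecreasing; first by rewrite le_max lexx.
  by rewrite ge_max !le_max lexx rs orbT.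
- exists (mdist x y) => _ [r _ <-]; rewrite /f.
  set s := Num.max m r.
  have S0 : metric_sphere y s !=set0.
    by apply: metric_sphere_nonempty; rewrite le_max mdist_ge0.
  rewrite lerBlDr; apply: le_trans (dist_set_triangle x y S0) _.
  by rewrite dist_set_metric_sphere.
Unshelve. all: by end_near. Qed.

Lemma sphere_limit_center x : sphere_limit x x = 0.
Proof.
apply: (@cvg_lim R^o) => //; apply: cvg_near_cst; near=> r.
rewrite dist_set_metric_sphere ?subrr//; apply: metric_sphere_nonempty.
by near: r; exact: nbhs_pinfty_ge (num_real _).
Unshelve. all: by end_near. Qed.

(** No point of [H] need realize [dist_set y H]: each [h] lies on a sphere about [y] of at least
    that radius, and monotonicity brings the bound down to the smaller sphere. *)
Lemma dist_set_ge_sphere x y (H : set X) : H !=set0 ->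
  mdist y x <= dist_set y H ->
  dist_set x (metric_sphere y (dist_set y H)) <= dist_set x H.
Proof.
move=> H0 yx; apply: le_dist_set => // h Hh.
have yh := dist_set_le y Hh.
have := dist_sphere_nondecreasing yx yh.
have /(dist_set_le x) : metric_sphere y (mdist y h) h by rewrite metric_sphereE.
lra.
Qed.

End SphereLimit.

(** Singletons are compact, so compact-open convergence can be tested on [[set x]]. *)
Lemma compact_open_cvg_at (T U : topologicalType) (F : set_system (T -> U))
    (f : T -> U) (x : T) : Filter F ->
  {compact-open, F --> f} -> g x @[g --> F] --> f x.
Proof.
move=> FF /compact_open_cvgP Ff A; rewrite nbhsE => -[B [oB Bfx] BA].
have := Ff [set x] B (@compact_set1 _ x) oB.
rewrite image_set1 sub1set inE => /(_ Bfx).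
by apply: (@filterS _ F) => g; rewrite /= image_set1 sub1set inE => /BA.
Qed.

(** A dl-function provides divergence from one base point only; moving that point changes the
    distances by a bounded amount. *)
Lemma dist_set_cvgy (R : realType) (X : metricType R) (H : nat -> set X)
    (x y : X) : (forall n, H n !=set0) ->
  dist_set x (H n) @[n --> \oo] --> +oo ->
  dist_set y (H n) @[n --> \oo] --> +oo.
Proof.
move=> H0 /cvgryPge xH; apply/cvgryPge => A.
near=> n; rewrite -(lerD2l (mdist x y)).
apply: le_trans (dist_set_triangle x y (H0 n)).
by near: n; exact: xH.
Unshelve. all: by end_near. Qed.

(** Supplies [X_unbounded]: any point of a far away [H n] will do. *)
Lemma dist_set_cvgy_unbounded (R : realType) (X : metricType R)
    (H : nat -> set X) (y : X) (r : R) : (forall n, H n !=set0) ->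
  dist_set y (H n) @[n --> \oo] --> +oo -> exists z, r <= mdist y z.
Proof.
move=> H0 /cvgryPge/(_ r)[n _ /(_ n (leqnn n)) /= rn].
by have [z Hz] := H0 n; exists z; exact: le_trans (dist_set_le _ Hz).
Qed.

Theorem proposition5p10 (R : realType) (X : metricType R)
    (X_complete : complete_space X)
    (X_connected : connected [set: X])
    (X_locally_compact : locally_compact [set: X])
    (X_noncompact : ~ compact [set: X])
    (X_geodesic : geodesic_space X)
    (u : X -> R) (u_dl : dl_function u) (x : X) :
  (u x)%:E = ereal_sup [set (u y + sphere_limit y x)%:E | y in [set: X]].
Proof.
have [H [c [H0 _ [x0 Hx0] Hu]]] := u_dl.
have Hy y : dist_set y (H n) @[n --> \oo] --> +oo by exact: dist_set_cvgy Hx0.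
have unb (y : X) r : exists z, r <= mdist y z.
  exact: dist_set_cvgy_unbounded (Hy y).
have u_lim y : dist_set y (H n) - c n @[n --> \oo] --> u y.
  exact: compact_open_cvg_at Hu.
apply/eqP; rewrite eq_le; apply/andP; split.
  by apply: ereal_sup_ubound; exists x => //;
    rewrite sphere_limit_center// addr0.
apply: ge_ereal_sup => _ [y _ <-]; rewrite lee_fin.
(* The radius [r] is specialized to [dist_set y (H n)], which tends to infinity; adding [u_lim y]
   then cancels this radius and leaves the distance from [x] to the sphere, minus [c n]. *)
have lim_r := cvg_comp _ _ (Hy y) (@sphere_limit_cvg _ _ X_geodesic unb x y).
apply: ler_cvg_to (cvgD (u_lim y) lim_r) (u_lim x) _.
near=> n; have yxn : mdist y x <= dist_set y (H n).
  by near: n; exact: cvgry_ge.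
have := dist_set_ge_sphere X_geodesic unb (H0 n) yxn.
rewrite fctE /=; lra.
Unshelve. all: by end_near. Qed.
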